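(* Let $A$ be a finite alphabet with at least two distinct letters and let $\{x_1,\ldots,x_n\}$ and $\{y_1,\ldots,y_m\}$ be disjoint sets of variables. Deciding the Inclusion of Pattern Languages problem for $\alpha\in (A\cup \{x_1,\ldots,x_n\})^*$ and $\beta\in (A\cup \{y_1,\ldots,y_m\})^*$, i.e. deciding whether $L(\alpha)\subseteq L(\beta)$, can be reduced to deciding whether the following formula holds or not in $A^*$: \[\exists x_1,\ldots,x_n.\ \forall y_1,\ldots,y_m.\ \alpha \neq \beta.\]
   Context: A pattern is a word over constants from $A$ and variables (disjoint from $A$). A substitution is a morphism $h$ from words over constants and variables to $A^*$ with $h(a)=a$ for all $a\in A$. The pattern language of $\alpha$ is $L(\alpha)=\{h(\alpha)\mid h\text{ is a substitution}\}$ (variables may be replaced by the empty word). In the formula, variables range over $A^*$, and $\alpha\ne\beta$ is satisfied by an assignment if the corresponding substitution $h$ has $h(\alpha)\neq h(\beta)$. *)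

(* Defs.v *)
From mathcomp Require Import all_boot.

Set Implicit Arguments.
Unset Strict Implicit.
Unset Printing Implicit Defensive.

(** * Patterns and pattern languages *)

(* Variables are named by natural numbers: [inl a] is the constant [a],
   [inr x] is the variable [x]. *)
Definition pattern (A : Type) := seq (A + nat).

Definition is_substitution (A : Type) (h : pattern A -> seq A) : Prop :=
  [/\ h [::] = [::],
      forall u v, h (u ++ v) = h u ++ h v
    & forall a, h [:: inl a] = [:: a]].

Definition pattern_language (A : Type) (alpha : pattern A) (w : seq A) : Prop :=
  exists2 h, is_substitution h & w = h alpha.

Definition language_incl (A : Type) (alpha beta : pattern A) : Prop :=
  forall w, pattern_language alpha w -> pattern_language beta w.

(** * Formulas over word equations, interpreted in [A^*] *)

Inductive formula (A : Type) :=
| Eq of pattern A & pattern A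
| Not of formula A
| Ex of nat & formula A
| All of nat & formula A.

Definition assignment (A : Type) := nat -> seq A.

Definition update (T : Type) (s : nat -> T) (x : nat) (t : T) : nat -> T :=
  fun y => if y == x then t else s y.

(* The substitution corresponding to an assignment. *)
Definition subst (A : Type) (s : assignment A) (alpha : pattern A) : seq A :=
  flatten [seq match c with inl a => [:: a] | inr x => s x end | c <- alpha].

Lemma subst_is_substitution (A : Type) (s : assignment A) :
  is_substitution (subst s).
Proof. by split=> // u v; rewrite /subst map_cat flatten_cat. Qed.

Lemma substitutionE (A : Type) (h : pattern A -> seq A) :
  is_substitution h -> h =1 subst (fun x => h [:: inr x]).
Proof.
case=> h0 hD hA; elim=> [//|c u IHu].
by rewrite -cat1s hD IHu /subst /=; case: c => // a; rewrite hA.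
Qed.

Fixpoint sat (A : Type) (s : assignment A) (phi : formula A) : Prop :=
  match phi with
  | Eq u v => subst s u = subst s v
  | Not psi => ~ sat s psi
  | Ex x psi => exists w : seq A, sat (update s x w) psi
  | All x psi => forall w : seq A, sat (update s x w) psi
  end.

(* The choice of the assignment does not matter for sentences. *)
Definition holds (A : Type) (phi : formula A) : Prop :=
  forall s : assignment A, sat s phi.

(** * Computability: the WHILE language of N. D. Jones, with an oracle *)

Inductive tree := Leaf | Node of tree & tree.

Inductive expr :=
| EVar of nat
| ELeaf
| ENode of expr & expr
| ELeft of expr
| ERight of expr.

Inductive cmd :=
| Assign of nat & expr
| Query of nat & expr
| Seq of cmd & cmd
| While of expr & cmd.

Definition store := nat -> tree.

Fixpoint eval (e : expr) (s : store) : tree :=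
  match e with
  | EVar x => s x
  | ELeaf => Leaf
  | ENode e1 e2 => Node (eval e1 s) (eval e2 s)
  | ELeft e1 => if eval e1 s is Node t _ then t else Leaf
  | ERight e1 => if eval e1 s is Node _ t then t else Leaf
  end.

(* [Query x e] asks whether the value of [e] belongs to the oracle set [O].
   As usual in WHILE, [Leaf] stands for false and any other tree for true. *)
Inductive exec (O : tree -> Prop) : cmd -> store -> store -> Prop :=
| ExecAssign x e s : exec O (Assign x e) s (update s x (eval e s))
| ExecQueryYes x e s :
    O (eval e s) -> exec O (Query x e) s (update s x (Node Leaf Leaf))
| ExecQueryNo x e s :
    ~ O (eval e s) -> exec O (Query x e) s (update s x Leaf)
| ExecSeq c1 c2 s1 s2 s3 :
    exec O c1 s1 s2 -> exec O c2 s2 s3 -> exec O (Seq c1 c2) s1 s3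
| ExecWhileFalse e c s : eval e s = Leaf -> exec O (While e c) s s
| ExecWhileTrue e c s1 s2 s3 :
    eval e s1 <> Leaf -> exec O c s1 s2 -> exec O (While e c) s2 s3 ->
    exec O (While e c) s1 s3.

Record problem := Problem {
  instance : Type;
  code : instance -> tree;
  yes : instance -> Prop
}.

(* Input and output are in variable 0. *)
Definition turing_reducible (P Q : problem) : Prop :=
  exists c : cmd, forall i : instance P,
    exists2 s : store,
      exec (fun t => exists2 j : instance Q, code j = t & yes j)
        c (update (fun=> Leaf) 0 (code i)) s
    & s 0 <> Leaf <-> yes i.

Fixpoint code_list (ts : seq tree) : tree :=
  if ts is t :: ts' then Node t (code_list ts') else Leaf.

Definition code_nat (n : nat) : tree := code_list (nseq n Leaf).

Definition code_pattern (A : finType) (alpha : pattern A) : tree :=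
  code_list [seq match c with
                 | inl a => Node Leaf (code_nat (enum_rank a))
                 | inr x => Node (Node Leaf Leaf) (code_nat x)
                 end | c <- alpha].

Fixpoint code_formula (A : finType) (phi : formula A) : tree :=
  match phi with
  | Eq u v => Node (code_nat 0) (Node (code_pattern u) (code_pattern v))
  | Not psi => Node (code_nat 1) (code_formula psi)
  | Ex x psi => Node (code_nat 2) (Node (code_nat x) (code_formula psi))
  | All x psi => Node (code_nat 3) (Node (code_nat x) (code_formula psi))
  end.

(** * The two decision problems *)

Record pattern_pair (A : finType) := PatternPair {
  xs : seq nat;
  ys : seq nat;
  lhs : pattern A;
  rhs : pattern A;
  uniq_vars : uniq (xs ++ ys);
  lhs_vars : forall x, inr x \in lhs -> x \in xs;
  rhs_vars : forall y, inr y \in rhs -> y \in ys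
}.

Definition code_pair (A : finType) (p : pattern_pair A) : tree :=
  Node (code_list (map code_nat (xs p)))
    (Node (code_list (map code_nat (ys p)))
       (Node (code_pattern (lhs p)) (code_pattern (rhs p)))).

Definition inclusion_problem (A : finType) : problem :=
  Problem (@code_pair A) (fun p => language_incl (lhs p) (rhs p)).

Definition exists_forall_neq (A : finType) (p : pattern_pair A) : formula A :=
  foldr (@Ex A) (foldr (@All A) (Not (Eq (lhs p) (rhs p))) (ys p)) (xs p).

Definition exists_forall_neq_problem (A : finType) : problem :=
  Problem (fun p : pattern_pair A => code_formula (exists_forall_neq p))
    (fun p => holds (exists_forall_neq p)).

(* Main.v *)
(** The reduction builds the code of the formula from the code of the pair,
    queries the oracle once, and negates the answer.  It is correct since the
    negation of the formula says that every [subst a alpha] equals some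
    [subst b beta]: as the two sets of variables are disjoint, [a] and [b] can
    be chosen independently. *)
Require Import Defs.
From mathcomp Require Import all_boot.
From Stdlib Require Import Classical.

Set Implicit Arguments.
Unset Strict Implicit.
Unset Printing Implicit Defensive.

(** * Pattern languages and blocks of quantifiers *)

Lemma pattern_languageP (A : Type) (alpha : pattern A) (w : seq A) :
  pattern_language alpha w <-> exists s, w = subst s alpha.
Proof.
split=> [[h /substitutionE hE ->] | [s ->]].
  by exists (fun x => h [:: inr x]); rewrite hE.
by exists (subst s) => //; apply: subst_is_substitution.
Qed.

Lemma eq_in_subst (A : eqType) (s s' : assignment A) (alpha : pattern A) :
  (forall x, inr x \in alpha -> s x = s' x) -> subst s alpha = subst s' alpha.
Proof.
move=> eq_s; congr flatten; apply/eq_in_map => -[a //|x]; exact: eq_s.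
Qed.

Lemma eq_update (T : Type) (s s' : nat -> T) (x : nat) (t : T) :
  s =1 s' -> update s x t =1 update s' x t.
Proof. by move=> eq_s y; rewrite /update eq_s. Qed.

(** Updates of one assignment along different routes agree only pointwise, so satisfaction has to be
    invariant under [=1]. *)
Lemma eq_sat (A : Type) (phi : formula A) (s s' : assignment A) :
  s =1 s' -> sat s phi <-> sat s' phi.
Proof.
elim: phi s s' => [u v|phi IH|x phi IH|x phi IH] s s' eq_s /=.
- suff eq_subst w : subst s w = subst s' w by rewrite !eq_subst.
  by congr flatten; apply: eq_map => -[].
- by rewrite (IH _ _ eq_s).
- by split=> -[w sat_w]; exists w; move: sat_w;
    rewrite (IH _ _ (eq_update x w eq_s)).
- by split=> sat_w w; move: (sat_w w); rewrite (IH _ _ (eq_update x w eq_s)).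
Qed.

Definition eq_off (T : Type) (vs : seq nat) (s s' : nat -> T) :=
  forall x, x \notin vs -> s x = s' x.

Lemma eq_off_update (T : Type) (v : nat) (vs : seq nat) (s s' : nat -> T)
    (t : T) :
  eq_off vs s' (update s v t) -> eq_off (v :: vs) s' s.
Proof.
move=> eq_s x; rewrite inE negb_or => /andP[/negPf xv /eq_s ->].
by rewrite /update xv.
Qed.

Lemma eq_off_cons (T : Type) (v : nat) (vs : seq nat) (s s' : nat -> T) :
  eq_off (v :: vs) s' s -> eq_off vs s' (update s v (s' v)).
Proof.
move=> eq_s x x_vs; rewrite /update; case: eqVneq => [->//|xv].
by apply: eq_s; rewrite inE negb_or xv.
Qed.

(** Collapses a block of quantifiers into a single one over assignments: [s' v] is the witness for
    the outermost variable, and induction treats the rest. *)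
Lemma sat_foldr_Ex (A : Type) (phi : formula A) (vs : seq nat)
    (s : assignment A) :
  sat s (foldr (@Ex A) phi vs) <-> exists2 s', eq_off vs s' s & sat s' phi.
Proof.
elim: vs s => [|v vs IH] s /=.
  split=> [sat_s|[s' eq_s]]; first by exists s.
  by apply: (eq_sat phi _).1 => x; apply: eq_s.
split=> [[w /IH[s' eq_s sat_s']]|[s' eq_s sat_s']].
  by exists s' => //; apply: eq_off_update eq_s.
by exists (s' v); apply/IH; exists s' => //; apply: eq_off_cons.
Qed.

Lemma sat_foldr_All (A : Type) (phi : formula A) (vs : seq nat)
    (s : assignment A) :
  sat s (foldr (@All A) phi vs) <-> forall s', eq_off vs s' s -> sat s' phi.
Proof.
elim: vs s => [|v vs IH] s /=.
  split=> [sat_s s' eq_s|]; last exact.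
  by apply: (eq_sat phi _).2 sat_s => x; apply: eq_s.
split=> [sat_s s' eq_s|sat_s w].
  by apply: ((IH _).1 (sat_s (s' v))); apply: eq_off_cons.
by apply/IH => s' eq_s; apply: sat_s; apply: eq_off_update eq_s.
Qed.

(** * Language inclusion and the negated formula *)

Section ExistsForall.

Variables (A : finType) (p : pattern_pair A).

Lemma sat_exists_forall_neq (s : assignment A) :
  sat s (exists_forall_neq p) <->
  exists a, forall b, subst a (lhs p) <> subst b (rhs p).
Proof.
have := uniq_vars p; rewrite cat_uniq => /and3P[_ /hasPn disj _].
rewrite /exists_forall_neq sat_foldr_Ex.
split=> [[a _ /sat_foldr_All neq]|[a neq]].
  (* By disjointness, [c] can follow [b] on [ys p] and still agree with [a] on the variables of
     [lhs p]. *)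
  exists a => b; pose c z := if z \in ys p then b z else a z.
  have c_off : eq_off (ys p) c a by move=> x /negPf x_ys; rewrite /c x_ys.
  have -> : subst a (lhs p) = subst c (lhs p).
    apply: eq_in_subst => x /lhs_vars x_xs; rewrite /c.
    by case: ifP => // /disj; rewrite x_xs.
  have -> : subst b (rhs p) = subst c (rhs p).
    by apply: eq_in_subst => y /rhs_vars y_ys; rewrite /c y_ys.
  exact: neq c_off.
(* The existential block may change [s] only on [xs p], so the witness follows [a] there and [s]
   elsewhere. *)
exists (fun z => if z \in xs p then a z else s z).
  by move=> x /negPf ->.
apply/sat_foldr_All => c c_off /=.
have -> : subst c (lhs p) = subst a (lhs p).
  apply: eq_in_subst => x /lhs_vars x_xs; rewrite c_off ?x_xs //.
  by apply/negP => /disj; rewrite x_xs.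
exact: neq.
Qed.

Lemma holds_exists_forall_neq :
  holds (exists_forall_neq p) <->
  exists a, forall b, subst a (lhs p) <> subst b (rhs p).
Proof.
split=> [sat_p | neq s]; last exact/sat_exists_forall_neq.
(* The right-hand side does not mention the assignment, so any single one will do. *)
exact: (sat_exists_forall_neq (fun=> [::])).1 (sat_p _).
Qed.

Lemma language_incl_exists_forall_neq :
  language_incl (lhs p) (rhs p) <-> ~ holds (exists_forall_neq p).
Proof.
rewrite holds_exists_forall_neq; split=> [incl [a neq]|not_neq w].
  have /incl/pattern_languageP[b] : pattern_language (lhs p) (subst a (lhs p)).
    by apply/pattern_languageP; exists a.
  exact: neq.
case/pattern_languageP => a ->; apply/pattern_languageP.
(* Classical step: if no [b] matched [a], then [a] would witness the formula. *)
apply: NNPP => not_ex; apply: not_neq; exists a => b eq_ab.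
by apply: not_ex; exists b.
Qed.

End ExistsForall.

(** * Injectivity of the encodings *)

Lemma code_list_inj : injective code_list.
Proof. by elim=> [|t ts IH] [|u us] //= [-> /IH->]. Qed.

Lemma code_nat_inj : injective code_nat.
Proof. by move=> m n /code_list_inj/(congr1 size); rewrite !size_nseq. Qed.

Lemma code_pattern_inj (A : finType) : injective (@code_pattern A).
Proof.
move=> u v /code_list_inj/inj_map; apply=> -[a|x] [b|y] //= [/code_nat_inj].
  by move/ord_inj/enum_rank_inj->.
by move->.
Qed.

(** The oracle sees only trees, so its answers must determine the formula. The tags 0 to 3 separate
    the constructors. *)
Lemma code_formula_inj (A : finType) : injective (@code_formula A).
Proof.
elim=> [u v|phi IH|x phi IH|x phi IH] [u' v'|psi|y psi|y psi] //=.
- by case=> /code_pattern_inj-> /code_pattern_inj->.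
- by case=> /IH->.
- by case=> /code_nat_inj-> /IH->.
- by case=> /code_nat_inj-> /IH->.
Qed.

(** * The WHILE program and its execution *)

Section Program.

Variable O : tree -> Prop.

(** A left fold: [x] holds the remaining list and [y] the accumulator. Since [y] is assigned first,
    [e] can still read the current head from [x]. *)
Definition fold_loop (x y : nat) (e : expr) : cmd :=
  While (EVar x) (Seq (Assign y e) (Assign x (ERight (EVar x)))).

Lemma exec_fold_loop (x y : nat) (e : expr) (f : tree -> tree -> tree)
    (ts : seq tree) (s : store) :
  x != y ->
  (forall s' t u, s' x = Node t u -> eval e s' = f (s' y) t) ->
  s x = code_list ts ->
  exists2 s', exec O (fold_loop x y e) s s' &
    s' y = foldl f (s y) ts /\ (forall z, z != x -> z != y -> s' z = s z).
Proof.
move=> neq_xy step; elim: ts s => [|t ts IH] s sx /=.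
  by exists s; first exact: ExecWhileFalse.
pose s1 := update s y (eval e s).
pose s2 := update s1 x (eval (ERight (EVar x)) s1).
have s1x : s1 x = s x by rewrite /s1 /update (negPf neq_xy).
have s2x : s2 x = code_list ts by rewrite /s2 {1}/update eqxx /= s1x sx.
have s2y : s2 y = f (s y) t.
  by rewrite /s2 /s1 /update eq_sym (negPf neq_xy) eqxx (step _ _ _ sx).
have [s' exec_s' [s'y s'z]] := IH s2 s2x; exists s'.
  apply: ExecWhileTrue exec_s'; first by rewrite /= sx.
  by apply: (@ExecSeq _ _ _ _ s1); apply: ExecAssign.
split=> [|z zx zy]; first by rewrite s'y s2y.
by rewrite s'z // /s2 /s1 /update (negPf zx) (negPf zy).
Qed.

Definition num (k : nat) : expr := iter k (ENode ELeaf) ELeaf.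

Lemma eval_num (k : nat) (s : store) : eval (num k) s = code_nat k.
Proof. by elim: k => //= k ->. Qed.

(* The formula nests the quantifiers from the inside out, so the list of
   variables is reversed (into 4) before it is folded into 2. *)
Definition quantify (k : nat) (e : expr) : cmd :=
  Seq (Assign 3 e) (Seq (Assign 4 ELeaf)
    (Seq (fold_loop 3 4 (ENode (ELeft (EVar 3)) (EVar 4)))
         (fold_loop 4 2 (ENode (num k) (ENode (ELeft (EVar 4)) (EVar 2)))))).

(** The first loop reverses the list, so the left fold of the second amounts to a right fold over
    [ts]. Variable 0 must survive because the input is read again for the next block. *)
Lemma exec_quantify (k : nat) (e : expr) (ts : seq tree) (s : store) :
  eval e s = code_list ts ->
  exists2 s', exec O (quantify k e) s s' &
    s' 2 = foldr (fun t u => Node (code_nat k) (Node t u)) (s 2) ts /\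
    s' 0 = s 0.
Proof.
move=> es; pose s1 := update s 3 (eval e s); pose s2 := update s1 4 Leaf.
have step1 s' t u : s' 3 = Node t u ->
    eval (ENode (ELeft (EVar 3)) (EVar 4)) s' = Node t (s' 4).
  by move=> /= ->.
have [s3 exec3 [s34 s3z]] :=
  @exec_fold_loop 3 4 _ (fun v t => Node t v) ts s2 isT step1 es.
have {}s34 : s3 4 = code_list (rev ts).
  rewrite s34 -[ts in LHS]revK foldl_rev.
  by elim: (rev ts) => //= t us ->.
have step2 s' t u : s' 4 = Node t u ->
    eval (ENode (num k) (ENode (ELeft (EVar 4)) (EVar 2))) s' =
    Node (code_nat k) (Node t (s' 2)).
  by move=> /= ->; rewrite eval_num.
have [s4 exec4 [s42 s4z]] :=
  @exec_fold_loop 4 2 _ (fun v t => Node (code_nat k) (Node t v)) _ s3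
    isT step2 s34.
exists s4; last by rewrite s42 s4z // !s3z // foldl_rev.
apply: (@ExecSeq _ _ _ _ s1); first exact: ExecAssign.
apply: (@ExecSeq _ _ _ _ s2); first exact: (ExecAssign _ 4 ELeaf).
exact: ExecSeq exec3 exec4.
Qed.

(** The loop acts as a conditional: the output starts as true, and a positive answer in variable 1
    runs the body once, clearing both variables. *)
Definition negated_query (e : expr) : cmd :=
  Seq (Query 1 e) (Seq (Assign 0 (num 1))
    (While (EVar 1) (Seq (Assign 0 ELeaf) (Assign 1 ELeaf)))).

Lemma exec_negated_query (e : expr) (s : store) :
  exists2 s', exec O (negated_query e) s s' & s' 0 <> Leaf <-> ~ O (eval e s).
Proof.
(* The oracle set is an arbitrary predicate, so splitting on its answer is classical. *)
have [Oe|nOe] := classic (O (eval e s)); last first.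
  exists (update (update s 1 Leaf) 0 (eval (num 1) (update s 1 Leaf))); last by [].
  apply: ExecSeq; first exact: ExecQueryNo.
  apply: ExecSeq; first exact: ExecAssign.
  exact: ExecWhileFalse.
eexists.
  apply: ExecSeq; first exact: ExecQueryYes.
  apply: ExecSeq; first exact: ExecAssign.
  apply: ExecWhileTrue => //; first by apply: ExecSeq; apply: ExecAssign.
  exact: ExecWhileFalse.
by split=> // /(_ Oe).
Qed.

(** Variable 2 starts as the code of the negated equation: tag 1, tag 0 ([ELeaf]), then the two
    pattern codes, which are already a subtree of the input. The inner universal block (tag 3) is
    added before the existential one (tag 2). *)
Definition exists_forall_reduction : cmd :=
  Seq (Assign 2 (ENode (num 1) (ENode ELeaf (ERight (ERight (EVar 0))))))
    (Seq (quantify 3 (ELeft (ERight (EVar 0))))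
      (Seq (quantify 2 (ELeft (EVar 0))) (negated_query (EVar 2)))).

Lemma exec_exists_forall_reduction (A : finType) (p : pattern_pair A) (s : store) :
  s 0 = code_pair p ->
  exists2 s', exec O exists_forall_reduction s s' &
    s' 0 <> Leaf <-> ~ O (code_formula (exists_forall_neq p)).
Proof.
move=> s0; pose s1 := update s 2 (eval
  (ENode (num 1) (ENode ELeaf (ERight (ERight (EVar 0))))) s).
have [s2 exec2 [s22 s20]] :=
  @exec_quantify 3 (ELeft (ERight (EVar 0))) (map code_nat (ys p)) s1
    ltac:(by rewrite /= /s1 /update /= s0).
have [s3 exec3 [s32 _]] :=
  @exec_quantify 2 (ELeft (EVar 0)) (map code_nat (xs p)) s2
    ltac:(by rewrite /= s20 /s1 /update /= s0).
have [s4 exec4 s4P] := exec_negated_query (EVar 2) s3.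
exists s4.
  apply: (ExecSeq (ExecAssign _ _ _ _)).
  exact: ExecSeq exec2 (ExecSeq exec3 exec4).
rewrite s4P [eval _ _]s32 s22 /s1 /update /= s0 /=.
suff -> : code_formula (exists_forall_neq p) =
  foldr (fun t u => Node (code_nat 2) (Node t u))
    (foldr (fun t u => Node (code_nat 3) (Node t u))
      (code_formula (Not (Eq (lhs p) (rhs p))))
      (map code_nat (ys p))) (map code_nat (xs p)) by [].
rewrite /exists_forall_neq.
elim: (xs p) => [|x vs /= -> //].
by elim: (ys p) => [|y vs /= ->].
Qed.

End Program.

Theorem theorem3p4 (A : finType) (hA : 1 < #|A|) :
  turing_reducible (inclusion_problem A) (exists_forall_neq_problem A)
  /\ (forall p : pattern_pair A,
        language_incl (lhs p) (rhs p) <-> ~ holds (exists_forall_neq p)).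
Proof.
split; last exact: language_incl_exists_forall_neq.
exists exists_forall_reduction => p; set O := (X in exec X).
have [s exec_s sP] :=
  @exec_exists_forall_reduction O A p (update (fun=> Leaf) 0 (code_pair p)) erefl.
exists s => //; rewrite sP /= language_incl_exists_forall_neq /O /=.
split=> not_p sat_p; apply: not_p; first by exists p.
(* The oracle only provides some pair [q] with the same formula code; injectivity transfers the
   truth of its formula to that of [p]. *)
by case: sat_p => q /code_formula_inj <-.
Qed.
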